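(* Let $H$ be an $r$-segment hypergraph. (a) If $r=2$, then $\chi(H) \le 4$. (b) If $r=3$, then $\chi(H) \le 3$. (c) If $r \ge 4$, then $\chi(H) = 2$. Additionally, the inequalities in (a) and (b) are sharp.
   Context: A hypergraph $H=(V,E)$ consists of a vertex set $V$ and an edge set $E \subset 2^V$. For an integer $r \ge 2$, a hypergraph $H=(V,E)$ with $V \subset \mathbb{Z}^2$ is an $r$-segment hypergraph if (i) every edge in $E$ consists of $r$ consecutive integer points (points of $\mathbb{Z}^2$) on some line in $\mathbb{R}^2$, and (ii) every line in $\mathbb{R}^2$ contains at most one edge of $H$. A hypergraph is $k$-colorable, for a positive integer $k$, if one can assign one of $k$ colors to each vertex in such a way that no edge is monochromatic; the chromatic number $\chi(H)$ is the least $k$ such that $H$ is $k$-colorable. Sharpness of (a) and (b) means that there is a $2$-segment hypergraph with chromatic number $4$ and a $3$-segment hypergraph with chromatic number $3$.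
   Formalization: In (c) the hypergraph H is additionally assumed to have at least one edge, since an r-segment hypergraph without edges has chromatic number 1, not 2. *)

(* Defs.v *)
From mathcomp Require Import all_boot all_order all_algebra.
From mathcomp Require Import all_classical all_reals.

Set Implicit Arguments.
Unset Strict Implicit.
Unset Printing Implicit Defensive.

Import Order.TTheory GRing.Theory Num.Theory.
Local Open Scope classical_set_scope.
Local Open Scope ring_scope.

(* The vertex set is an arbitrary, possibly infinite, subset of T. *)
Record hypergraph (T : Type) := Hypergraph {
  vertices : set T;
  edges : set (set T);
  edges_sub : forall e, edges e -> e `<=` vertices
}.

Definition monochromatic (T : Type) (c : T -> nat) (e : set T) : Prop :=
  exists i : nat, forall v : T, e v -> c v = i.

(* The colors are 0, ..., k - 1; values of c outside the vertex set are
   irrelevant, since edges consist of vertices. *)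
Definition colorable (T : Type) (H : hypergraph T) (k : nat) : Prop :=
  exists c : T -> nat,
    (forall v : T, vertices H v -> (c v < k)%N) /\
    (forall e : set T, edges H e -> ~ monochromatic c e).

(* chi(H) = k. This is a relation because chi(H) need not exist for a general
   hypergraph; k ranges over positive integers, so that chi(H) = 1 when H has
   no edges, even if it has no vertices either. *)
Definition is_chromatic_number (T : Type) (H : hypergraph T) (k : nat) : Prop :=
  [/\ (0 < k)%N, colorable H k &
      forall j : nat, (0 < j)%N -> colorable H j -> (k <= j)%N].

Definition is_line (R : realType) (L : set (R * R)) : Prop :=
  exists a b c : R,
    (a != 0 \/ b != 0) /\ L = [set p | a * p.1 + b * p.2 = c].

Definition int_point (R : realType) (p : int * int) : R * R :=
  (p.1%:~R, p.2%:~R).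

(* x lies on the closed segment with endpoints p and q *)
Definition between (R : realType) (p q x : R * R) : Prop :=
  exists t : R, 0 <= t <= 1 /\
    x = ((1 - t) * p.1 + t * q.1, (1 - t) * p.2 + t * q.2).

Definition contains_points (R : realType) (L : set (R * R))
    (e : set (int * int)) : Prop :=
  @int_point R @` e `<=` L.

(* Consecutive means that no integer point of L is skipped between two points
   of e. *)
Definition consecutive_on (R : realType) (L : set (R * R)) (r : nat)
    (e : set (int * int)) : Prop :=
  [/\ (e #= `I_r)%card,
      contains_points L e &
      forall p q z : int * int, e p -> e q -> L (int_point R z) ->
        between (int_point R p) (int_point R q) (int_point R z) -> e z].

Definition segment_hypergraph (R : realType) (r : nat)
    (H : hypergraph (int * int)) : Prop :=
  (forall e, edges H e ->
     exists L : set (R * R), is_line L /\ consecutive_on L r e) /\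
  (forall L : set (R * R), is_line L ->
     forall e e', edges H e -> edges H e' ->
       contains_points L e -> contains_points L e' -> e = e').

(* Main.v *)
(* An edge of an r-segment hypergraph contains s, s + d, ..., s + (r - 1) d
   with d primitive.  Upper bounds come from colorings of Z^2 that are periodic
   mod 2, 3 and 4 for r = 2, 3 and r >= 4, in which no such progression is
   monochromatic.
   For sharpness, the four vertices of the unit square span a K4, and 18
   segments of length 3 on 16 points of the 5 x 5 grid, found by computer
   search, lie on distinct lines and admit no 2-coloring. *)
Require Import Defs.
From mathcomp Require Import all_boot all_order all_algebra.
From mathcomp Require Import all_classical all_reals.
From mathcomp Require Import zify ring lra.

Set Implicit Arguments.
Unset Strict Implicit.
Unset Printing Implicit Defensive.

Import Order.TTheory GRing.Theory Num.Theory.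
Local Open Scope classical_set_scope.

(** * Integer points of lines and primitive arithmetic progressions *)

Section LatticeLines.
Local Open Scope ring_scope.

Definition lattice_pt (s d : int * int) (k : int) : int * int :=
  (s.1 + k * d.1, s.2 + k * d.2).

Definition lattice_segment (r : nat) (s d : int * int) : set (int * int) :=
  [set lattice_pt s d i%:Z | i in `I_r].

Lemma lattice_pt0 s d : lattice_pt s d 0 = s.
Proof. by case: s => x y; rewrite /lattice_pt /= !mul0r !addr0. Qed.

Lemma lattice_ptD s d j k :
  lattice_pt (lattice_pt s d j) d k = lattice_pt s d (j + k).
Proof. by rewrite /lattice_pt /=; congr pair; ring. Qed.

Lemma lattice_pt_inj s d : coprimez d.1 d.2 -> injective (lattice_pt s d).
Proof.
move=> /coprimezP[[u v] /= uv] j k [/addrI e1 /addrI e2].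
have E (i : int) : i = u * (i * d.1) + v * (i * d.2).
  by rewrite -[LHS]mulr1 -uv; ring.
by rewrite (E j) (E k) e1 e2.
Qed.

Lemma mem_lattice_segment r s d i :
  (i < r)%N -> lattice_segment r s d (lattice_pt s d i%:Z).
Proof. by move=> ir; exists i. Qed.

Variable R : realType.
Implicit Types (L : set (R * R)) (e : set (int * int)).

(** A displacement along [L] is parallel to [d]; a Bezout relation for the coprime coordinates of
    [d] makes the ratio an integer. *)
Lemma line_int_points L p d : is_line L -> coprimez d.1 d.2 ->
  L (int_point R p) -> L (int_point R (lattice_pt p d 1)) ->
  forall z, L (int_point R z) <-> exists k, z = lattice_pt p d k.
Proof.
case=> [a [b [c [ab ->]]]] /coprimezP[[u v] /= uv] /= Lp.
rewrite /int_point /= !mul1r !rmorphD /= => Ld.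
have abd : a * d.1%:~R + b * d.2%:~R = 0 by lra.
move=> z; split=> [Lz|[k ->]]; last first.
  rewrite /= !rmorphD !rmorphM /= -[RHS]addr0 -(mulr0 k%:~R) -abd -Lp; ring.
pose w1 := z.1 - p.1; pose w2 := z.2 - p.2.
have abw : a * w1%:~R + b * w2%:~R = 0 by rewrite /w1 /w2 !rmorphB /=; lra.
(* The nonzero normal [(a, b)] kills both [w] and [d], so their determinant vanishes. *)
have cross : w1 * d.2 = w2 * d.1.
  apply/eqP; rewrite -subr_eq0 -(intr_eq0 R) rmorphB !rmorphM /=; apply/eqP.
  set W1 : R := w1%:~R in abw *; set W2 : R := w2%:~R in abw *.
  set D1 : R := d.1%:~R in abd *; set D2 : R := d.2%:~R in abd *.
  case: ab => /mulfI; apply; rewrite mulr0.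
    have -> : a * (W1 * D2 - W2 * D1) =
      (a * W1 + b * W2) * D2 - W2 * (a * D1 + b * D2) by ring.
    by rewrite abw abd; ring.
  have -> : b * (W1 * D2 - W2 * D1) =
    W1 * (a * D1 + b * D2) - (a * W1 + b * W2) * D1 by ring.
  by rewrite abw abd; ring.
exists (u * w1 + v * w2); rewrite /lattice_pt.
have -> : (u * w1 + v * w2) * d.1 = w1.
  rewrite -[RHS]mul1r -uv; transitivity (u * w1 * d.1 + v * (w2 * d.1)).
    ring.
  rewrite -cross; ring.
have -> : (u * w1 + v * w2) * d.2 = w2.
  rewrite -[RHS]mul1r -uv; transitivity (u * (w1 * d.2) + v * w2 * d.2).
    ring.
  rewrite cross; ring.
by rewrite /w1 /w2 {1}[z]surjective_pairing; congr pair; ring.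
Qed.

(** The direction is [q - p] divided by the gcd of its coordinates. *)
Lemma line_direction L p q : is_line L -> p != q ->
  L (int_point R p) -> L (int_point R q) ->
  exists2 d, coprimez d.1 d.2 &
    forall z, L (int_point R z) <-> exists k, z = lattice_pt p d k.
Proof.
move=> Ll pq Lp Lq.
set g := gcdz (q.1 - p.1) (q.2 - p.2).
have g0 : g != 0.
  rewrite gcdz_eq0 !subr_eq0; apply: contra pq => /andP[/eqP e1 /eqP e2].
  by rewrite [p]surjective_pairing [q]surjective_pairing e1 e2.
have [d d1 d2] : exists2 d : int * int,
    d.1 * g = q.1 - p.1 & d.2 * g = q.2 - p.2.
  exists (((q.1 - p.1) %/ g)%Z, ((q.2 - p.2) %/ g)%Z);
    by rewrite divzK // (dvdz_gcdl, dvdz_gcdr).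
have cd : coprimez d.1 d.2.
  have [u [v uv]] := Bezoutz (q.1 - p.1) (q.2 - p.2).
  apply/coprimezP; exists (u, v) => /=; apply: (mulIf g0).
  by rewrite mul1r -[RHS]uv mulrDl -!mulrA d1 d2.
exists d => //; apply: line_int_points => //.
have [a [b [c [_ LE]]]] := Ll.
move: Lp Lq; rewrite LE /int_point /= !mul1r.
have -> : q.1 = p.1 + d.1 * g by rewrite d1 addrC subrK.
have -> : q.2 = p.2 + d.2 * g by rewrite d2 addrC subrK.
rewrite !rmorphD !rmorphM /= => Lp Lq.
have gR : (g%:~R : R) != 0 by rewrite intr_eq0.
(* The normal kills [q - p = g d], hence [d], which puts [p + d] on [L]. *)
have : g%:~R * (a * d.1%:~R + b * d.2%:~R) = 0 :> R.
  apply: (addrI c); rewrite addr0 -{1}Lp -Lq; ring.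
by move/eqP; rewrite mulf_eq0 (negPf gR) /= => /eqP h; lra.
Qed.

Lemma between_lattice_pt p d (j m k : int) : j <= m <= k ->
  between (int_point R (lattice_pt p d j)) (int_point R (lattice_pt p d k))
    (int_point R (lattice_pt p d m)).
Proof.
(* The case [j = k] is separate because [t] has denominator [k - j]. *)
move=> /andP[jm mk]; have [kj|jk] := leP k j.
  have -> : m = j by lia.
  exists 0; split; first by rewrite lexx ler01.
  by rewrite subr0 !mul1r !mul0r !addr0.
have jkR : 0 < (k - j)%:~R :> R by rewrite ltr0z subr_gt0.
pose t : R := (m - j)%:~R / (k - j)%:~R.
have tE : t * (k%:~R - j%:~R) = m%:~R - j%:~R.
  by rewrite -!rmorphB /= divfK // gt_eqF.
exists t; split.
  rewrite divr_ge0 ?ler0z ?subr_ge0 ?(ltW jk) //=.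
  by rewrite ler_pdivrMr // mul1r ler_int lerD2r.
rewrite /int_point /= !rmorphD !rmorphM /=.
have -> : m%:~R = j%:~R + t * (k%:~R - j%:~R) by rewrite tE addrC subrK.
by congr pair; ring.
Qed.

(** Combining the two coordinate equations with Bezout coefficients shows that [m] is the convex
    combination of [j] and [k] with the same [t]. *)
Lemma between_lattice_ptE p d (j m k : int) : coprimez d.1 d.2 ->
  between (int_point R (lattice_pt p d j)) (int_point R (lattice_pt p d k))
    (int_point R (lattice_pt p d m)) ->
  (j <= m <= k) || (k <= m <= j).
Proof.
move=> /coprimezP[[u v] /= /(congr1 (fun x : int => x%:~R : R))].
rewrite rmorphD !rmorphM rmorph1 /= => uv [t [/andP[t0 t1]]].
rewrite /int_point /= !rmorphD !rmorphM /= => -[e1 e2].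
have E : m%:~R = (1 - t) * j%:~R + t * k%:~R :> R.
  have f1 : m%:~R * d.1%:~R = ((1 - t) * j%:~R + t * k%:~R) * d.1%:~R :> R.
    by apply: (addrI p.1%:~R); rewrite e1; ring.
  have f2 : m%:~R * d.2%:~R = ((1 - t) * j%:~R + t * k%:~R) * d.2%:~R :> R.
    by apply: (addrI p.2%:~R); rewrite e2; ring.
  transitivity (u%:~R * (m%:~R * d.1%:~R) + v%:~R * (m%:~R * d.2%:~R) : R).
    by rewrite -[LHS]mulr1 -[X in _ * X = _]uv; ring.
  rewrite f1 f2; set c := (1 - t) * _ + _.
  by rewrite -[RHS]mulr1 -[X in _ = _ * X]uv; ring.
rewrite -!(ler_int R) E; have [jk|/ltW kj] := leP j k.
  have : (j%:~R : R) <= k%:~R by rewrite ler_int.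
  by move=> ?; apply/orP; left; apply/andP; split; nra.
have : (k%:~R : R) <= j%:~R by rewrite ler_int.
by move=> ?; apply/orP; right; apply/andP; split; nra.
Qed.

Lemma seq_int_min (s : seq int) : s != [::] ->
  exists2 m, m \in s & forall x, x \in s -> m <= x.
Proof.
elim: s => // x s IH _; have [->|/IH[m ms mmin]] := eqVneq s [::].
  by exists x => [|y]; rewrite !inE // => /eqP ->.
have [xm|/ltW mx] := leP x m.
  exists x => [|y]; rewrite inE ?eqxx // => /predU1P[->//|/mmin].
  exact: le_trans.
by exists m => [|y]; rewrite inE ?ms ?orbT // => /predU1P[->//|/mmin].
Qed.

(** Start at the least parameter [k0] of a point of [e]. If [k0 + i] were missing for some [i < r],
    consecutiveness would forbid points of [e] beyond it, leaving only [i] places for [r] points. *)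
Lemma consecutive_on_segment L r e : (2 <= r)%N ->
  is_line L -> consecutive_on L r e ->
  exists s d, coprimez d.1 d.2 /\ lattice_segment r s d `<=` e.
Proof.
move=> r2 Ll [er Le convex].
have efin : finite_set e by exists r.
have [p [q [ep eq pq]]] : exists p q, [/\ e p, e q & p != q].
  apply: contrapT => h.
  have : (e #<= `I_1)%card.
    have [->|/set0P[p ep]] := eqVneq e set0; first exact: card_ge0.
    suff -> : e = [set p].
      by rewrite (card_le_eql card_set1) card_le_II.
    apply/seteqP; split=> [q eq|q ->//] /=; apply/eqP/negP => /negP pq.
    by apply: h; exists q, p.
  by rewrite (card_le_eql er) card_le_II leqNgt r2.
have Lpt z : e z -> L (int_point R z) by move=> ez; apply: Le; exists z.
have [d cd Lz] := line_direction Ll pq (Lpt _ ep) (Lpt _ eq).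
(* Injectivity of the parametrization makes the set of parameters finite, so it has a minimum. *)
have [K eK] : exists K : seq int, lattice_pt p d @^-1` e = [set` K].
  apply/finite_seqP; apply: finite_preimage => // j k _ _.
  exact: lattice_pt_inj.
have KE k : e (lattice_pt p d k) <-> k \in K.
  by rewrite -[e _]/((_ @^-1` e) k) eK.
have [|k0 k0K k0min] := @seq_int_min K.
  by apply/eqP => K0; have := (KE 0).1; rewrite lattice_pt0 K0 => /(_ ep).
exists (lattice_pt p d k0), d; split=> // _ [i /= ir <-].
rewrite lattice_ptD; apply: contrapT => ne.
have sub : e `<=` lattice_segment i (lattice_pt p d k0) d.
  move=> z ez; have [k zk] := (Lz z).1 (Lpt z ez).
  have kK : k \in K by apply/KE; rewrite -zk.
  have k0k := k0min k kK.
  have [ik|ki] := leP (k0 + i%:Z) k.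
    case: ne; apply: (convex (lattice_pt p d k0) z).
    - exact/KE.
    - by [].
    - by apply/Lz; exists (k0 + i%:Z).
    - by rewrite zk; apply: between_lattice_pt; rewrite lerDl ik.
  exists `|k - k0|%N => /=; first by lia.
  by rewrite lattice_ptD zk; congr lattice_pt; lia.
have := card_le_trans (subset_card_le sub) (card_image_le _ _).
by rewrite (card_le_eql er) card_le_II leqNgt ir.
Qed.

Lemma lattice_segmentP r s d : (2 <= r)%N -> coprimez d.1 d.2 ->
  exists L, is_line L /\ consecutive_on L r (lattice_segment r s d).
Proof.
move=> r2 cd.
set L := [set z : R * R | d.2%:~R * z.1 + (- d.1%:~R) * z.2
                        = d.2%:~R * s.1%:~R - d.1%:~R * s.2%:~R].
have Ll : is_line L.
  exists d.2%:~R, (- d.1%:~R), (d.2%:~R * s.1%:~R - d.1%:~R * s.2%:~R).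
  split=> //; rewrite oppr_eq0 !intr_eq0; apply/orP.
  by move: cd; apply: contraTT; rewrite negb_or !negbK => /andP[/eqP-> /eqP->].
have Lpt k : L (int_point R (lattice_pt s d k)).
  by rewrite /L /int_point /= !rmorphD !rmorphM /=; ring.
exists L; split=> //; split.
- rewrite (card_eql (inj_card_eq _)) ?card_eqxx // => i j _ _.
  by move=> /(lattice_pt_inj cd) [].
- by move=> _ [_ [i _ <-] <-]; exact: Lpt.
- move=> _ _ z [i /= ir <-] [j /= jr <-] Lz.
  have L0 := Lpt 0; rewrite lattice_pt0 in L0.
  have [k ->] := (line_int_points Ll cd L0 (Lpt 1) z).1 Lz.
  (* Lying between [i] and [j], the parameter [k] is nonnegative and below [r]. *)
  move=> /(between_lattice_ptE cd) ijk.
  exists `|k|%N; first by rewrite /=; lia.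
  by congr lattice_pt; lia.
Qed.

(** Both [s'] and [s' + d'] are points [s + j d] and [s + k d], so [d' = (k - j) d]. The conclusion
    is phrased by integer determinants so that collinearity can be tested by computation. *)
Lemma same_line_segments L r s d s' d' : (2 <= r)%N -> is_line L ->
  coprimez d.1 d.2 -> contains_points L (lattice_segment r s d) ->
  contains_points L (lattice_segment r s' d') ->
  d.1 * (s'.2 - s.2) = d.2 * (s'.1 - s.1) /\ d.1 * d'.2 = d.2 * d'.1.
Proof.
move=> r2 Ll cd Le Le'.
have LE := line_int_points Ll cd _ _.
have Ls i : (i < r)%N -> L (int_point R (lattice_pt s d i%:Z)).
  by move=> ir; apply: Le; exists (lattice_pt s d i%:Z); [exists i|].
have Ls' i : (i < r)%N -> L (int_point R (lattice_pt s' d' i%:Z)).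
  by move=> ir; apply: Le'; exists (lattice_pt s' d' i%:Z); [exists i|].
have L0 := Ls 0%N (ltnW r2); rewrite lattice_pt0 in L0.
have {}LE := LE s L0 (Ls 1%N r2).
have [j s'E] := (LE _).1 (Ls' 0%N (ltnW r2)).
have [k d'E] := (LE _).1 (Ls' 1%N r2).
move: s'E d'E; rewrite lattice_pt0 => ->.
rewrite /lattice_pt /= !mul1r -!addrA => -[/addrI d1 /addrI d2].
have -> : d'.1 = (k - j) * d.1 by rewrite mulrBl -d1 addrAC subrr add0r.
have -> : d'.2 = (k - j) * d.2 by rewrite mulrBl -d2 addrAC subrr add0r.
by split; ring.
Qed.

(** * Hypergraphs given by finite lists of (start, direction) pairs *)

Definition segment_points (r : nat) (sd : (int * int) * (int * int)) :
  seq (int * int) := [seq lattice_pt sd.1 sd.2 i%:Z | i <- iota 0 r].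

Lemma segment_pointsE r s d :
  lattice_segment r s d = [set` segment_points r (s, d)].
Proof.
apply/seteqP; split=> [_ [i /= ir <-]|z /=].
  by apply/mapP; exists i; rewrite ?mem_iota.
by move=> /mapP[i]; rewrite mem_iota => ir ->; exists i.
Qed.

Definition segments_hypergraph (r : nat)
  (S : seq ((int * int) * (int * int))) : hypergraph (int * int) :=
  Hypergraph (vertices := setT)
    (edges := [set lattice_segment r sd.1 sd.2 | sd in [set` S]])
    (fun e _ => @subsetT _ e).

Definition same_line (sd sd' : (int * int) * (int * int)) : bool :=
  (sd.2.1 * (sd'.1.2 - sd.1.2) == sd.2.2 * (sd'.1.1 - sd.1.1)) &&
  (sd.2.1 * sd'.2.2 == sd.2.2 * sd'.2.1).

Definition segments_valid (S : seq ((int * int) * (int * int))) : bool :=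
  all (fun sd => coprimez sd.2.1 sd.2.2) S &&
  all (fun sd => all (fun sd' => same_line sd sd' ==> (sd == sd')) S) S.

Lemma segments_hypergraphP r S : (2 <= r)%N -> segments_valid S ->
  segment_hypergraph R r (segments_hypergraph r S).
Proof.
move=> r2 /andP[/allP cop /allP dist]; split.
  by move=> _ [sd /= /cop cd <-]; exact: lattice_segmentP.
move=> L Ll _ _ [sd /= sdS <-] [sd' /= sdS' <-] Le Le'.
have [e1 e2] := same_line_segments r2 Ll (cop _ sdS) Le Le'.
have /allP/(_ _ sdS')/implyP := dist _ sdS.
by rewrite /same_line e1 e2 !eqxx => /(_ isT)/eqP->.
Qed.

End LatticeLines.

(** * Colorings of the integer grid read off a finite table *)

Section PeriodicColorings.
Local Open Scope nat_scope.

Definition tab (t : seq (seq nat)) (x y : nat) : nat := nth 0 (nth [::] t x) y.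

Definition periodic_color (m : nat) (t : seq (seq nat)) (z : int * int) : nat :=
  tab t `|(z.1 %% m)%Z|%N `|(z.2 %% m)%Z|%N.

(* p is a prime factor of m: a direction congruent to (a, b) mod m with p
   dividing both a and b is not primitive, hence irrelevant. *)
Definition good_table (r p m k : nat) (t : seq (seq nat)) : bool :=
  let I := iota 0 m in
  all (fun x => all (fun y => (tab t x y < k) &&
    all (fun a => all (fun b => (p %| a) && (p %| b) ||
      has (fun i => tab t ((x + i * a) %% m) ((y + i * b) %% m) != tab t x y)
        (iota 0 r)) I) I) I) I.

Lemma absz_modz_lt (m : nat) (x : int) : 0 < m -> `|(x %% m)%Z| < m.
Proof. by move=> m0; lia. Qed.

Lemma absz_modz_progression (m i : nat) (x a : int) : 0 < m ->
  `|((x + i%:Z * a)%R %% m)%Z| = (`|(x %% m)%Z| + i * `|(a %% m)%Z|) %% m.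
Proof.
move=> m0; apply/eqP; rewrite -eqz_nat -modz_nat PoszD PoszM; apply/eqP.
have abs (z : int) : Posz `|(z %% m)%Z| = (z %% m)%Z.
  by rewrite gez0_abs // modz_ge0 // eqz_nat -lt0n.
by rewrite !abs modzDml -[RHS]modzDmr modzMmr modzDmr.
Qed.

Variable R : realType.

(** Colors depend only on residues, so the table test finds, among the first [r] points of the
    progression in an edge, one colored unlike [s]. As [r <= n] suffices, one table serves all
    longer segments. *)
Lemma good_table_colorable r p m k t (H : hypergraph (int * int)) n :
  1 < p -> p %| m -> 0 < m -> 2 <= n -> r <= n -> good_table r p m k t ->
  segment_hypergraph R n H -> colorable H k.
Proof.
move=> p1 pm m0 n2 rn good [seg _].
have I z : `|(z %% m)%Z|%N \in iota 0 m by rewrite mem_iota absz_modz_lt.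
have goodz (z : int * int) :=
  andP (allP (allP good _ (I z.1)) _ (I z.2)).
exists (periodic_color m t); split=> [z _|e /seg]; first by have [] := goodz z.
case=> [L [Ll /(consecutive_on_segment n2 Ll)[s [d [cd se]]]]] [c mono].
have [_ /allP/(_ _ (I d.1))/allP/(_ _ (I d.2))] := goodz s.
(* In the exempted case [p], a divisor of [m], divides both coordinates of [d] and not just their
   residues, against coprimality. *)
case/orP=> [/andP[pd1 pd2]|/hasP[i]].
  have dvd (z : int) : p %| `|(z %% m)%Z| -> (p %| z)%Z.
    rewrite -[p %| _]/(p %| (z %% m))%Z => h.
    by rewrite (divz_eq z m) rpredD // dvdz_mull.
  have := dvdz_gcd p d.1 d.2; rewrite (dvd _ pd1) (dvd _ pd2) (eqP cd).
  by rewrite dvdz1 /= => /eqP p1'; rewrite p1' in p1.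
rewrite mem_iota add0n => ir; rewrite -!absz_modz_progression // => /eqP; apply.
have sc j : j < r -> periodic_color m t (lattice_pt s d j%:Z) = c.
  by move=> jr; apply/mono/se/mem_lattice_segment/(leq_trans jr).
have r0 : 0 < r by apply: leq_ltn_trans ir.
by have := sc 0 r0; rewrite lattice_pt0 -(sc i ir).
Qed.

End PeriodicColorings.

(** * From colorability to the chromatic number *)

Lemma colorable_chromatic (T : Type) (H : hypergraph T) (k : nat) :
  (0 < k)%N -> colorable H k ->
  exists j : nat, is_chromatic_number H j /\ (j <= k)%N.
Proof.
move=> k0 Hk.
have ex : exists j, (0 < j)%N && `[<colorable H j>].
  by exists k; rewrite k0; apply/asboolP.
case: (ex_minnP ex) => j /andP[j0 /asboolP Hj] jmin.
exists j; split; [split=> // i i0 Hi|]; apply: jmin.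
  by rewrite i0; apply/asboolP.
by rewrite k0; apply/asboolP.
Qed.

Lemma colorable1_edgeless (T : Type) (H : hypergraph T) :
  colorable H 1 -> edges H = set0.
Proof.
case=> c [c1 mono]; apply/seteqP; split=> // e He; apply: (mono e He).
exists 0%N => v ev; apply/eqP.
by rewrite -leqn0 -ltnS; apply/c1/(edges_sub He).
Qed.

Lemma colorableS (T : Type) (H : hypergraph T) (j k : nat) :
  (j <= k)%N -> colorable H j -> colorable H k.
Proof.
move=> jk [c [cj mono]]; exists c; split=> // v /cj.
by move=> /leq_trans; apply.
Qed.

(** * Examples attaining the bounds *)

Section Sharpness.

Definition K4_segments : seq ((int * int) * (int * int)) :=
  [:: ((0, 0), (1, 0)); ((0, 0), (0, 1)); ((0, 0), (1, 1));
      ((1, 0), (-1, 1)); ((1, 0), (0, 1)); ((0, 1), (1, 0))]%R.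

Lemma K4_segments_not_colorable :
  ~ colorable (segments_hypergraph 2 K4_segments) 3.
Proof.
case=> c [c3 mono].
have neq s d : (s, d) \in K4_segments ->
    c (lattice_pt s d 0%R) != c (lattice_pt s d 1%R).
  move=> sd; apply/eqP => eqc; apply: (mono (lattice_segment 2 s d)).
    by exists (s, d).
  exists (c (lattice_pt s d 1%R)) => _ [i /= i2 <-].
  by case: i i2 => [|[|]].
have := neq (0, 0)%R (1, 0)%R isT.
have := neq (0, 0)%R (0, 1)%R isT.
have := neq (0, 0)%R (1, 1)%R isT.
have := neq (1, 0)%R (-1, 1)%R isT.
have := neq (1, 0)%R (0, 1)%R isT.
have := neq (0, 1)%R (1, 0)%R isT.
rewrite /lattice_pt /=.
rewrite !(mul0r, mul1r, addr0, add0r) addrN.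
have := c3 (0, 0)%R I; have := c3 (1, 0)%R I.
have := c3 (0, 1)%R I; have := c3 (1, 1)%R I.
(* Four pairwise distinct colors below 3 are impossible, by enumeration. *)
by case: (c (1, 1)%R) (c (0, 1)%R) (c (1, 0)%R) (c (0, 0)%R) =>
  [|[|[|?]]] [|[|[|?]]] [|[|[|?]]] [|[|[|?]]].
Qed.

(* T and F are the points colored so far, ps the order of branching.  The test
   is an [if] because vm_compute would evaluate both sides of [||]. *)
Fixpoint two_coloring_refuted (es : seq (seq (int * int)))
    (ps T F : seq (int * int)) : bool :=
  if has (fun e => all (mem T) e || all (mem F) e) es then true
  else if ps is p :: ps' then
    two_coloring_refuted es ps' (p :: T) F &&
    two_coloring_refuted es ps' T (p :: F)
  else false.

(** Descend the search tree into the branch matching [f p] at each point; the leaf reached has an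
    edge inside [T] or inside [F]. *)
Lemma two_coloring_refutedP es ps T F (f : int * int -> bool) :
  two_coloring_refuted es ps T F ->
  {in T, forall p, f p = true} -> {in F, forall p, f p = false} ->
  exists2 e, e \in es & exists b, {in e, forall p, f p = b}.
Proof.
have mono T' F' : has (fun e => all (mem T') e || all (mem F') e) es ->
    {in T', forall p, f p = true} -> {in F', forall p, f p = false} ->
    exists2 e, e \in es & exists b, {in e, forall p, f p = b}.
  move=> /hasP[e ees eTF] fT fF; exists e => //.
  by case/orP: eTF => /allP sub; [exists true|exists false] => q /sub;
    [apply: fT|apply: fF].
elim: ps T F => [|p ps IH] T F /=; case: ifP => [/mono h _|_]; rewrite ?h //.
case/andP=> rT rF fT fF.
case fp: (f p).
  by apply: (IH _ _ rT) => // q; rewrite inE => /predU1P[->//|/fT].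
by apply: (IH _ _ rF) => // q; rewrite inE => /predU1P[->//|/fF].
Qed.

Lemma two_coloring_refuted_segments r S ps :
  two_coloring_refuted (map (segment_points r) S) ps [::] [::] ->
  ~ colorable (segments_hypergraph r S) 2.
Proof.
move=> refuted [c [c2 mono]].
have [] := two_coloring_refutedP (f := fun z => c z == 0%N) refuted => //.
move=> _ /mapP[[s d] sdS ->] [b cb]; apply: (mono (lattice_segment r s d)).
  by exists (s, d).
(* The boolean coloring is [c z == 0], so [b] true means color 0 and [b] false means color 1. *)
exists (~~ b : nat) => z; rewrite segment_pointsE => /cb.
by have := c2 z I; case: (c z) => [|[|]] //= _ <-.
Qed.

Definition grid_segments : seq ((int * int) * (int * int)) :=
  [:: ((0, 0), (1, 0)); ((0, 0), (1, 1)); ((0, 0), (1, 2));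
      ((0, 2), (0, 1)); ((0, 2), (1, -1)); ((0, 2), (1, 0));
      ((0, 2), (1, 1)); ((0, 2), (2, 1)); ((0, 3), (1, 0));
      ((0, 3), (2, -1)); ((0, 4), (1, -2)); ((1, 0), (0, 1));
      ((1, 0), (1, 2)); ((1, 2), (1, 1)); ((2, 0), (1, 2));
      ((2, 2), (0, 1)); ((2, 3), (1, -1)); ((2, 4), (1, 0))]%R.

(* A branching order found by search, keeping the tree at 647 nodes. *)
Definition grid_points : seq (int * int) :=
  [:: (2, 2); (1, 2); (0, 2); (2, 3); (2, 4); (3, 4); (4, 4); (1, 0); (1, 1);
      (0, 0); (2, 0); (0, 4); (0, 3); (3, 2); (4, 1); (1, 3)]%R.

Lemma grid_segments_not_colorable :
  ~ colorable (segments_hypergraph 3 grid_segments) 2.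
Proof.
by apply: (@two_coloring_refuted_segments _ _ grid_points); vm_compute.
Qed.

End Sharpness.

(** * The three tables and the theorem *)

Lemma good_table2 : good_table 2 2 2 4 [:: [:: 0; 1]; [:: 2; 3]].
Proof. by []. Qed.

(** The color counts the coordinates congruent to 2 mod 3. Along a direction nonzero mod 3, each
    coordinate is constant or takes every residue once, and not both are constant; the three colors
    thus sum to 1 or 2 mod 3 and cannot be equal. *)
Lemma good_table3 :
  good_table 3 3 3 3 [:: [:: 0; 0; 1]; [:: 0; 0; 1]; [:: 1; 1; 2]].
Proof. by []. Qed.

(** A direction with an odd coordinate has order 4 mod 4, so the four points fill a coset of a
    cyclic subgroup of order 4; no such coset is monochromatic in this table. *)
Lemma good_table4 : good_table 4 2 4 2
  [:: [:: 1; 1; 0; 1]; [:: 0; 0; 1; 0]; [:: 1; 0; 0; 0]; [:: 1; 0; 0; 0]].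
Proof. by []. Qed.

Lemma not_colorable_chromatic (T : Type) (H : hypergraph T) (k : nat) :
  colorable H k.+1 -> ~ colorable H k -> is_chromatic_number H k.+1.
Proof.
move=> Hk nHk; split=> // j _ Hj; rewrite ltnNge; apply/negP => jk.
exact/nHk/(colorableS jk).
Qed.

Theorem theorem2p2 (R : realType) :
  (forall (r : nat) (H : hypergraph (int * int)),
     (2 <= r)%N -> segment_hypergraph R r H ->
     [/\ r = 2%N -> exists k : nat, is_chromatic_number H k /\ (k <= 4)%N,
         r = 3%N -> exists k : nat, is_chromatic_number H k /\ (k <= 3)%N &
         (4 <= r)%N -> edges H !=set0 -> is_chromatic_number H 2%N]) /\
  (exists H : hypergraph (int * int),
     segment_hypergraph R 2%N H /\ is_chromatic_number H 4%N) /\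
  (exists H : hypergraph (int * int),
     segment_hypergraph R 3%N H /\ is_chromatic_number H 3%N).
Proof.
split; [move=> r H r2 Hseg; split|split].
- move=> rE; rewrite rE in Hseg; apply: colorable_chromatic => //.
  exact: good_table_colorable good_table2 Hseg.
- move=> rE; rewrite rE in Hseg; apply: colorable_chromatic => //.
  exact: good_table_colorable good_table3 Hseg.
(* The lower bound comes from the edge [e], which a single color would make monochromatic. *)
- move=> r4 [e He]; apply: not_colorable_chromatic.
    exact: good_table_colorable good_table4 Hseg.
  by move/colorable1_edgeless => H0; rewrite H0 in He.
- exists (segments_hypergraph 2 K4_segments).
  have Hseg := @segments_hypergraphP R 2 K4_segments isT isT.
  (* The matching upper bound is the coloring of (a) applied to the example itself. *)
  split=> //; apply: not_colorable_chromatic K4_segments_not_colorable.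
  exact: good_table_colorable good_table2 Hseg.
- exists (segments_hypergraph 3 grid_segments).
  have Hseg := @segments_hypergraphP R 3 grid_segments isT isT.
  split=> //; apply: not_colorable_chromatic grid_segments_not_colorable.
  exact: good_table_colorable good_table3 Hseg.
Qed.
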